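(* For every time step size $\tau>0$ and every $n\ge 0$, the iterates $(u^n,s^n)$ of the GSAV-EI1 scheme satisfy $$\mathcal{E}_h(u^{n+1},s^{n+1})\le \mathcal{E}_h(u^n,s^n).$$
   Context: Spatial setting. Let $L>0$, $\Omega=(0,L)\times(0,L)$, $|\Omega|=L^2$, $M$ a positive integer, $h=L/M$. Let $\mathcal{M}_h$ be the finite-dimensional space of real grid functions $v=(v_{ij})_{i,j\in\mathbb{Z}}$ that are $M$-periodic in each index. For $v,w\in\mathcal{M}_h$ set $\langle v,w\rangle=h^2\sum_{i,j=1}^M v_{ij}w_{ij}$, $\|v\|=\sqrt{\langle v,v\rangle}$, $\|v\|_\infty=\max_{1\le i,j\le M}|v_{ij}|$; for pairs of grid functions $\mathbf v=(v^1,v^2)$, $\mathbf w=(w^1,w^2)$ set $\langle \mathbf v,\mathbf w\rangle=\langle v^1,w^1\rangle+\langle v^2,w^2\rangle$ and $\|\mathbf v\|=\sqrt{\langle \mathbf v,\mathbf v\rangle}$. The discrete Laplacian is $\Delta_h v_{ij}=h^{-2}(v_{i+1,j}+v_{i-1,j}+v_{i,j+1}+v_{i,j-1}-4v_{ij})$ and the discrete gradient is $\nabla_h v_{ij}=\big(\frac{v_{i+1,j}-v_{ij}}{h},\frac{v_{i,j+1}-v_{ij}}{h}\big)^T$. Scalar functions act on grid functions pointwise; functions of self-adjoint linear operators on $\mathcal{M}_h$ are understood as matrix functions; $I$ is the identity. Standing assumptions. $\varepsilon>0$; $f:\mathbb{R}\to\mathbb{R}$ is continuously differentiable and there is a constant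 $\beta>0$ (fixed) with $f(\beta)\le 0\le f(-\beta)$; $F$ is a function with $F'=-f$; $u_{\rm init}\in\mathcal{M}_h$ is the (grid-projected) initial value; $\kappa>0$ is a stabilizing constant; $\sigma:\mathbb{R}\to\mathbb{R}$ is continuously differentiable with $\sigma>0$ and $\sigma'\ge0$ on $\mathbb{R}$. Energies. $E_{1h}(v)=\langle F(v),1\rangle$, $E_h(v)=\frac{\varepsilon^2}{2}\|\nabla_h v\|^2+E_{1h}(v)$, and the modified energy is $\mathcal{E}_h(v,r)=\frac{\varepsilon^2}{2}\|\nabla_h v\|^2+r$, for $v\in\mathcal{M}_h$, $r\in\mathbb{R}$. Set $g(v,r)=\sigma(r)/\sigma(E_{1h}(v))$. GSAV-EI1 scheme with step $\tau>0$. $u^0=u_{\rm init}$, $s^0=E_{1h}(u^0)$, and for $n\ge0$, with $L_\kappa^n=\kappa g(u^n,s^n)I-\varepsilon^2\Delta_h$, $N_\kappa^n(v,r)=g(v,r)f(v)+\kappa g(u^n,s^n)v$, and $\phi_1(a)=a^{-1}(e^a-1)$ for $a\ne0$, $$u^{n+1}=e^{-\tau L_\kappa^n}u^n+\tau\phi_1(-\tau L_\kappa^n)N_\kappa^n(u^n,s^n),\qquad s^{n+1}=s^n-g(u^n,s^n)\langle f(u^n),u^{n+1}-u^n\rangle.$$ *)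

(* Defs.v *)
From mathcomp Require Import all_boot all_order all_algebra.
From mathcomp Require Import all_classical all_reals all_analysis.
From mathcomp Require complex.
Set Implicit Arguments.
Unset Strict Implicit.
Unset Printing Implicit Defensive.
Import Order.TTheory GRing.Theory Num.Theory.
Import numFieldNormedType.Exports.
Local Open Scope ring_scope.

(* An M-periodic grid function is represented by its values on one period,
   v : 'M[R]_M.  The indices run over 0, ..., M-1 and the neighbours i+1, i-1
   are the cyclic ordS i, ord_pred i. *)

Definition gdot (R : realType) (M : nat) (h : R) (v w : 'M[R]_M) : R :=
  h ^+ 2 * \sum_(i < M) \sum_(j < M) v i j * w i j.

Definition gdot2 (R : realType) (M : nat) (h : R)
    (v w : 'M[R]_M * 'M[R]_M) : R :=
  gdot h v.1 w.1 + gdot h v.2 w.2.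

Definition gnorm2 (R : realType) (M : nat) (h : R)
    (v : 'M[R]_M * 'M[R]_M) : R :=
  Num.sqrt (gdot2 h v v).

Definition lap (R : realType) (M : nat) (h : R) (v : 'M[R]_M) : 'M[R]_M :=
  \matrix_(i, j) (h ^- 2 *
    (v (ordS i) j + v (ord_pred i) j + v i (ordS j) + v i (ord_pred j)
     - 4 * v i j)).

Definition grad (R : realType) (M : nat) (h : R) (v : 'M[R]_M) :
    'M[R]_M * 'M[R]_M :=
  (\matrix_(i, j) ((v (ordS i) j - v i j) / h),
   \matrix_(i, j) ((v i (ordS j) - v i j) / h)).

Definition spectral_decomp (R : realType) (n : nat) (A : 'M[R]_n)
    (Pd : 'M[R]_n * 'rV[R]_n) : Prop :=
  Pd.1 *m Pd.1^T = 1%:M /\ A = Pd.1^T *m diag_mx Pd.2 *m Pd.1.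

(* phi(A) = P^T diag(phi(d)) P for A = P^T diag(d) P with P orthogonal.
   A decomposition exists for every symmetric A (spectral_decomp_exists) and
   the value does not depend on its choice (mxfunE). *)
Definition mxfun (R : realType) (n : nat) (phi : R -> R) (A : 'M[R]_n) :
    'M[R]_n :=
  let Pd := xget (1%:M, 0) [set Pd | spectral_decomp A Pd]%classic in
  Pd.1^T *m diag_mx (map_mx phi Pd.2) *m Pd.1.

Section RealEigenvector.
Import complex.

Lemma sym_eigenvector (R : realType) (n : nat) (A : 'M[R]_n.+1) :
  A^T = A -> exists a (v : 'rV[R]_n.+1), v *m v^T = 1%:M /\ v *m A = a *: v.
Proof.
move=> symA; pose B := map_mx (real_complex R) A.
have [c Bc] := eigenvalue_closed B (ltn0Sn n).
have [w wB w0] := eigenvalueP Bc.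
have conjB : map_mx Num.conj B = B.
  by apply/matrixP => i j; rewrite !mxE; apply/CrealP/complex_realP; exists (A i j).
have ww : (w *m (map_mx Num.conj w)^T) 0 0 != 0.
  rewrite mxE psumr_eq0 => [|i _]; last by rewrite !mxE mul_conjC_ge0.
  apply: contra w0 => /allP w0; apply/eqP/rowP => i; rewrite mxE.
  by have := w0 i (mem_index_enum _); rewrite !mxE mul_conjC_eq0 => /eqP.
have /CrealP/complex_realP[a ac] : Num.conj c = c.
  have wBw := congr1 (fun X => X *m (map_mx Num.conj w)^T) wB.
  have wBw' : w *m B *m (map_mx Num.conj w)^T
      = Num.conj c *: (w *m (map_mx Num.conj w)^T).
    rewrite -mulmxA; have -> : B = (map_mx Num.conj B)^T.
      by rewrite conjB /B map_trmx symA.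
    rewrite -trmx_mul -map_mxM wB scalemxAr; congr (_ *m _).
    by apply/matrixP => i j; rewrite !mxE rmorphM.
  move: wBw' => /esym; rewrite wBw -scalemxAl => /matrixP/(_ 0 0).
  rewrite [LHS]mxE [RHS]mxE => /eqP.
  by rewrite -subr_eq0 -mulrBl mulf_eq0 (negPf ww) orbF subr_eq0 => /eqP.
have /eigenvalueP[v vA v0] : eigenvalue A a.
  move: Bc; rewrite !eigenvalue_root_char ac /B -map_char_poly.
  by rewrite /root horner_map /= -[X in _ == X](rmorph0 (real_complex R)) (inj_eq (@complexI R)).
have vv : 0 < (v *m v^T) 0 0.
  rewrite lt0r mxE sumr_ge0 ?andbT => [|i _]; last by rewrite !mxE -expr2 sqr_ge0.
  rewrite psumr_eq0 => [|i _]; last by rewrite !mxE -expr2 sqr_ge0.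
  apply: contra v0 => /allP v0; apply/eqP/rowP => i; rewrite mxE.
  by have := v0 i (mem_index_enum _); rewrite !mxE mulf_eq0 orbb => /eqP.
exists a, ((Num.sqrt ((v *m v^T) 0 0))^-1 *: v); split; last first.
  by rewrite -scalemxAl vA !scalerA mulrC.
apply/matrixP => i j; rewrite !ord1 linearZ /= -scalemxAl -scalemxAr scalerA.
rewrite mxE [RHS]mxE eqxx -invfM -expr2 sqr_sqrtr ?ltW //.
by rewrite mulVf ?gt_eqF.
Qed.

End RealEigenvector.

Lemma complete_orthogonal (R : realType) (n : nat) (v : 'rV[R]_n.+1) :
  v *m v^T = 1%:M -> exists Q : 'M[R]_n.+1, Q *m Q^T = 1%:M /\ row 0 Q = v.
Proof.
move=> vv; pose e : 'rV[R]_n.+1 := delta_mx 0 0.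
have [<-|ev] := eqVneq e v.
  by exists 1%:M; rewrite trmx1 mulmx1 row1.
pose w := e - v; pose s := (w *m w^T) 0 0.
have s0 : s != 0.
  rewrite /s mxE psumr_eq0 => [|i _]; last by rewrite !mxE -expr2 sqr_ge0.
  apply: contra ev => /allP w0; rewrite -subr_eq0; apply/eqP/rowP => i.
  have := w0 i (mem_index_enum _); rewrite ![w^T _ _]mxE mulf_eq0 orbb => /eqP w0i.
  by rewrite -/w w0i mxE.
have wws : w *m w^T = s%:M by rewrite [LHS]mx11_scalar.
pose H : 'M[R]_n.+1 := 1%:M - (2 / s) *: (w^T *m w).
have HT : H^T = H by rewrite /H linearB /= trmx1 linearZ /= trmx_mul trmxK.
exists H; split.
  have ww2 : w^T *m w *m (w^T *m w) = s *: (w^T *m w).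
    by rewrite mulmxA -(mulmxA w^T) wws mul_mx_scalar -scalemxAl.
  rewrite HT {2}/H mulmxBr mulmx1 -scalemxAr {1 2}/H mulmxBl mul1mx -scalemxAl ww2 scalerA.
  by rewrite divfK // scaler_nat mulr2n opprD addrA subrr sub0r scalerN opprK subrK.
have ee : e *m e^T = 1%:M.
  by rewrite /e trmx_delta mul_delta_mx; apply/matrixP => i j; rewrite !ord1 !mxE !eqxx.
have sE : s = 2 * (e *m w^T) 0 0.
  have ewT : e *m w^T = 1%:M - e *m v^T by rewrite /w linearB /= mulmxBr ee.
  have veT : v *m e^T = e *m v^T.
    by rewrite [RHS]mx11_scalar -tr_scalar_mx -mx11_scalar trmx_mul trmxK.
  have -> : s = (e *m w^T + e *m w^T) 0 0.
    have wT : w^T = e^T - v^T by rewrite /w linearB.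
    rewrite /s {1}/w mulmxBl {2}wT mulmxBr veT vv ewT.
    by rewrite opprB.
  by rewrite mxE mulr_natl mulr2n.
rewrite rowE -/e /H mulmxBr mulmx1 -scalemxAr mulmxA.
rewrite [e *m w^T]mx11_scalar mul_scalar_mx scalerA.
rewrite [X in X *: _](_ : _ = 1); last by rewrite mulrAC -sE divff.
by rewrite scale1r /w opprB addrC subrK.
Qed.

Lemma spectral_decomp_exists (R : realType) (n : nat) (A : 'M[R]_n) :
  A^T = A -> exists Pd, spectral_decomp A Pd.
Proof.
elim: n A => [|n IHn] A symA.
  by exists (0, 0); split; apply/matrixP => -[].
have [a [v [vv vA]]] := sym_eigenvector symA.
have [Q [QQ Qv]] := complete_orthogonal vv.
have QQ' := mulmx1C QQ.
pose B : 'M[R]_(1 + n) := Q *m A *m Q^T.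
have symB : B^T = B by rewrite /B !trmx_mul trmxK symA mulmxA.
have B0 : row 0 B = a *: delta_mx 0 0.
  rewrite /B !row_mul Qv vA -scalemxAl; congr (_ *: _).
  by rewrite -Qv -row_mul QQ row1.
have urB : ursubmx B = 0.
  apply/matrixP => i j; rewrite !ord1 !mxE.
  have /rowP/(_ (rshift 1 j)) := B0; rewrite [LHS]mxE !mxE /= mulr0 => Bj.
  by rewrite (_ : lshift n 0 = 0) //; apply/val_inj.
have ulB : ulsubmx B = a%:M.
  apply/matrixP => i j; rewrite !ord1 !mxE.
  have l0 : lshift n 0 = 0 :> 'I_(1 + n) by apply/val_inj.
  have /rowP/(_ 0) := B0; rewrite [LHS]mxE !mxE !eqxx mulr1 => B00.
  by rewrite l0 mulr1n.
have dlB : dlsubmx B = 0 by rewrite -[B]symB -trmx_ursub urB trmx0.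
have [|[P d] /= [PP drB]] := IHn (drsubmx B).
  by rewrite trmx_drsub symB.
have BE : B = block_mx a%:M 0 0 (P^T *m diag_mx d *m P).
  by rewrite -[LHS]submxK ulB urB dlB drB.
pose P1 : 'M[R]_(1 + n) := block_mx 1%:M 0 0 P.
have P1T : P1^T = block_mx 1%:M 0 0 P^T by rewrite tr_block_mx !trmx0 trmx1.
have PP1 : P1 *m P1^T = 1%:M.
  rewrite P1T mulmx_block !mulmx0 !mul0mx !addr0 add0r mulmx1 PP.
  by rewrite -scalar_mx_block.
have BP1 : B = P1^T *m diag_mx (row_mx a%:M d) *m P1.
  rewrite BE P1T diag_mx_row !mulmx_block.
  rewrite !mulmx0 !mul0mx !addr0 !add0r mulmx1 mul1mx; congr block_mx; rewrite ?mul0mx //.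
  by apply/matrixP => i j; rewrite !ord1 !mxE.
pose Pd : 'M[R]_n.+1 * 'rV[R]_n.+1 := (P1 *m Q, row_mx a%:M d).
exists Pd; rewrite /Pd; split => /=.
  by rewrite trmx_mul mulmxA -(mulmxA P1) QQ mulmx1 PP1.
have -> : A = Q^T *m B *m Q by rewrite /B !mulmxA QQ' mul1mx -mulmxA QQ' mulmx1.
by rewrite BP1 trmx_mul !mulmxA.
Qed.

Lemma mxfunE (R : realType) (n : nat) (phi : R -> R) (A : 'M[R]_n)
    (P : 'M[R]_n) (d : 'rV[R]_n) :
  spectral_decomp A (P, d) ->
  mxfun phi A = P^T *m diag_mx (map_mx phi d) *m P.
Proof.
move=> AP; rewrite /mxfun.
have := xgetI (1%:M, 0) (AP : [set Pd | spectral_decomp A Pd]%classic (P, d)).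
case: (xget _ _) => Q d' /= [/= QQ AQ]; case: AP => /= PP AP.
have QQ' := mulmx1C QQ; have PP' := mulmx1C PP.
pose W := Q *m P^T.
have dW : diag_mx d' *m W = W *m diag_mx d.
  have : Q *m A *m P^T = Q *m A *m P^T by [].
  rewrite {1}AQ {1}AP !mulmxA QQ mul1mx -(mulmxA (Q *m P^T *m _)) PP mulmx1.
  by rewrite -mulmxA.
have phiW : diag_mx (map_mx phi d') *m W = W *m diag_mx (map_mx phi d).
  apply/matrixP => i j; move/matrixP/(_ i j): dW.
  rewrite !mul_diag_mx !mul_mx_diag ![(\matrix_(_, _) _) _ _]mxE !mxE.
  have [->|W0] := eqVneq (\sum_j0 Q i j0 * P^T j0 j) 0; first by rewrite !(mulr0, mul0r).
  by rewrite mulrC => /(mulfI W0) ->; rewrite mulrC.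
rewrite -[LHS]mulmx1 -PP' mulmxA -[X in X *m P]mulmxA -[X in X *m P]mulmxA.
by rewrite phiW /W !mulmxA QQ' mul1mx.
Qed.
(* lin_mx A is the matrix of A in the canonical basis; it is symmetric iff A is
   self-adjoint for gdot, as the weight h ^+ 2 is the same at all points. *)
Definition opfun (R : realType) (M : nat) (phi : R -> R)
    (A : 'M[R]_M -> 'M[R]_M) (v : 'M[R]_M) : 'M[R]_M :=
  vec_mx (mxvec v *m mxfun phi (lin_mx A)).

(* Only the case a != 0 matters below; 1 is the continuous extension. *)
Definition phi1 (R : realType) (a : R) : R :=
  if a == 0 then 1 else a^-1 * (expR a - 1).

Definition C1 (R : realType) (f : R -> R) : Prop :=
  (forall x : R, derivable f x 1) /\ continuous (derive1 f).

Definition E1h (R : realType) (M : nat) (h : R) (F : R -> R) (v : 'M[R]_M) : R :=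
  gdot h (map_mx F v) (const_mx 1).

Definition modified_energy (R : realType) (M : nat) (h eps : R)
    (v : 'M[R]_M) (r : R) : R :=
  eps ^+ 2 / 2 * gnorm2 h (grad h v) ^+ 2 + r.

Definition gfac (R : realType) (M : nat) (h : R) (F sigma : R -> R)
    (v : 'M[R]_M) (r : R) : R :=
  sigma r / sigma (E1h h F v).

Definition Lop (R : realType) (M : nat) (h eps kappa : R) (F sigma : R -> R)
    (un : 'M[R]_M) (sn : R) (v : 'M[R]_M) : 'M[R]_M :=
  (kappa * gfac h F sigma un sn) *: v - eps ^+ 2 *: lap h v.

Definition Nop (R : realType) (M : nat) (h kappa : R) (f F sigma : R -> R)
    (un : 'M[R]_M) (sn : R) (v : 'M[R]_M) (r : R) : 'M[R]_M :=
  gfac h F sigma v r *: map_mx f v + (kappa * gfac h F sigma un sn) *: v.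

Definition gsav_step (R : realType) (M : nat) (h eps kappa tau : R)
    (f F sigma : R -> R) (us : 'M[R]_M * R) : 'M[R]_M * R :=
  let un := us.1 in
  let sn := us.2 in
  let A := fun v => - tau *: Lop h eps kappa F sigma un sn v in
  let un1 := opfun (@expR R) A un
    + tau *: opfun (@phi1 R) A (Nop h kappa f F sigma un sn un sn) in
  (un1, sn - gfac h F sigma un sn * gdot h (map_mx f un) (un1 - un)).

Fixpoint gsav_ei1 (R : realType) (M : nat) (h eps kappa tau : R)
    (f F sigma : R -> R) (uinit : 'M[R]_M) (n : nat) : 'M[R]_M * R :=
  if n is m.+1
  then gsav_step h eps kappa tau f F sigma
         (gsav_ei1 h eps kappa tau f F sigma uinit m)
  else (uinit, E1h h F uinit).

(* Main.v *)
(* On an eigenvector of [A := - tau L] with eigenvalue [d], the increment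
   [w := u^{n+1} - u^n] is [phi1 d * q], where [q] is the component of
   [A u^n + tau N].  The energy decrease times [tau] is
   [<A u^n + tau N, w> + <A w, w> / 2 + tau kappa g <w, w> / 2]; its first two
   terms contribute [phi1 d * q^2 * (1 + d * phi1 d / 2)] on the eigenvector,
   which is nonnegative as [phi1 > 0] and [d * phi1 d = e^d - 1 > -1]. *)
Require Import Defs.
From HB Require Import structures.
From mathcomp Require Import all_boot all_order all_algebra.
From mathcomp Require Import all_classical all_reals all_analysis.
From mathcomp Require Import ring lra.
Set Implicit Arguments.
Unset Strict Implicit.
Unset Printing Implicit Defensive.
Import Order.TTheory GRing.Theory Num.Theory.
Import numFieldNormedType.Exports.
Local Open Scope ring_scope.

Section DiscreteInnerProduct.
Context (R : realType) (M : nat) (h : R).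
Implicit Types (v w z : 'M[R]_M) (a : R).

Lemma gdotC v w : gdot h v w = gdot h w v.
Proof.
by congr (_ * _); apply: eq_bigr => i _; apply: eq_bigr => j _; rewrite mulrC.
Qed.

Lemma gdotDl v w z : gdot h (v + w) z = gdot h v z + gdot h w z.
Proof.
rewrite /gdot -mulrDr -big_split; congr (_ * _); apply: eq_bigr => i _ /=.
by rewrite -big_split; apply: eq_bigr => j _ /=; rewrite !mxE mulrDl.
Qed.

Lemma gdotZl a v z : gdot h (a *: v) z = a * gdot h v z.
Proof.
rewrite /gdot mulrCA; congr (_ * _); rewrite mulr_sumr; apply: eq_bigr => i _.
by rewrite mulr_sumr; apply: eq_bigr => j _; rewrite mxE mulrA.
Qed.

Lemma gdotDr v w z : gdot h z (v + w) = gdot h z v + gdot h z w.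
Proof. by rewrite gdotC gdotDl !(gdotC z). Qed.

Lemma gdotZr a v z : gdot h z (a *: v) = a * gdot h z v.
Proof. by rewrite gdotC gdotZl gdotC. Qed.

Lemma gdot_ge0 v : 0 <= gdot h v v.
Proof.
rewrite mulr_ge0 ?sqr_ge0 // sumr_ge0 // => i _.
by rewrite sumr_ge0 // => j _; rewrite -expr2 sqr_ge0.
Qed.

(** Links the inner product on grid functions to the dot product of row vectors, on which [lin_mx A]
    acts. *)
Lemma gdot_mxvec v w :
  gdot h v w = h ^+ 2 * \sum_k mxvec v 0 k * mxvec w 0 k.
Proof.
congr (_ * _); rewrite pair_bigA /=.
rewrite (reindex _ (curry_mxvec_bij M M)) /=.
by apply: eq_bigr => -[i j] _ /=; rewrite !mxvecE.
Qed.

(** Shifting the index of the terms with [b (ordS i)] by [ord_pred] leaves [b i] as a common factor;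
    the shift is a cyclic permutation, so no boundary terms appear. *)
Lemma summation_by_parts (a b : 'I_M -> R) :
  \sum_i (a (ordS i) - a i) * (b (ordS i) - b i)
    = - \sum_i (a (ordS i) + a (ord_pred i) - 2 * a i) * b i.
Proof.
under eq_bigr do rewrite mulrBr.
rewrite sumrB (reindex_inj (can_inj (@ord_predK M))) /=.
under eq_bigr do rewrite ord_predK.
rewrite -sumrB -sumrN; apply: eq_bigr => i _; ring.
Qed.

Lemma gdot2_grad v w : gdot2 h (grad h v) (grad h w) = - gdot h (lap h v) w.
Proof.
rewrite /gdot2 /gdot -mulrDr -mulrN; congr (_ * _).
(* The first component differs along [i], so the sums are exchanged to sum by parts in [i] for each
   fixed [j]. *)
have -> : \sum_i \sum_j (grad h v).1 i j * (grad h w).1 i j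
    = h ^- 2 * \sum_j - \sum_i
        (v (ordS i) j + v (ord_pred i) j - 2 * v i j) * w i j.
  rewrite exchange_big mulr_sumr; apply: eq_bigr => j _ /=.
  rewrite -(summation_by_parts (v^~ j) (w^~ j)) mulr_sumr.
  by apply: eq_bigr => i _; rewrite !mxE mulrACA -invfM -expr2 mulrC.
have -> : \sum_i \sum_j (grad h v).2 i j * (grad h w).2 i j
    = h ^- 2 * \sum_i - \sum_j
        (v i (ordS j) + v i (ord_pred j) - 2 * v i j) * w i j.
  rewrite mulr_sumr; apply: eq_bigr => i _ /=.
  rewrite -(summation_by_parts (v i) (w i)) mulr_sumr.
  by apply: eq_bigr => j _; rewrite !mxE mulrACA -invfM -expr2 mulrC.
rewrite !sumrN exchange_big /= -mulrDr -opprD -big_split mulrN mulr_sumr /=.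
congr (- _); apply: eq_bigr => i _; rewrite -big_split mulr_sumr /=.
by apply: eq_bigr => j _; rewrite mxE; ring.
Qed.

(** Both sides are minus the inner product of the two gradients, which is symmetric. *)
Lemma gdot_lapC v w : gdot h (lap h v) w = gdot h v (lap h w).
Proof.
apply: oppr_inj; rewrite (gdotC v) -!gdot2_grad /gdot2.
by rewrite (gdotC _.1) (gdotC _.2).
Qed.

Lemma lap_is_linear : linear (@lap R M h).
Proof. by move=> a v w; apply/matrixP => i j; rewrite !mxE; ring. Qed.

Lemma gnorm2_grad v : gnorm2 h (grad h v) ^+ 2 = - gdot h (lap h v) v.
Proof.
by rewrite /gnorm2 sqr_sqrtr ?gdot2_grad // -gdot2_grad addr_ge0 ?gdot_ge0.
Qed.

End DiscreteInnerProduct.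

(** For [x] nonzero, [expR x - 1] has the sign of [x]. *)
Lemma phi1_gt0 (R : realType) (x : R) : 0 < phi1 x.
Proof.
rewrite /phi1; have [//|x0] := eqVneq x 0.
have [x_lt0|x_ge0] := ltP x 0.
  by rewrite nmulr_rgt0 ?invr_lt0 // subr_lt0 expR_lt1.
by rewrite mulr_gt0 ?invr_gt0 ?subr_gt0 ?expR_gt1 // lt0r x0.
Qed.

(** Removes the case distinction in [phi1]: at 0 both sides vanish. *)
Lemma mulr_phi1 (R : realType) (x : R) : x * phi1 x = expR x - 1.
Proof.
rewrite /phi1; have [->|x0] := eqVneq x 0; first by rewrite expR0 mul0r subrr.
by rewrite mulVKf.
Qed.

Section SelfAdjoint.
Context (R : realType) (M : nat) (A : {linear 'M[R]_M -> 'M[R]_M}).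

(** Up to the factor [h ^+ 2], the entry [(k, l)] of [lin_mx A] is the inner product of [A e_k] with
    [e_l], for the canonical basis [e]. *)
Lemma lin_mx_sym (h : R) : h != 0 ->
  (forall v w, gdot h (A v) w = gdot h v (A w)) -> (lin_mx A)^T = lin_mx A.
Proof.
move=> h0 adjA; apply/matrixP => i j; rewrite mxE.
have E k l : lin_mx A k l =
    \sum_m mxvec (A (vec_mx (delta_mx 0 k))) 0 m * mxvec (vec_mx (delta_mx 0 l)) 0 m.
  rewrite (bigD1 l) //= big1 => [|m /negPf ml]; last first.
    by rewrite vec_mxK [X in _ * X]mxE ml andbF mulr0.
  by rewrite vec_mxK !mxE !eqxx /= mulr1 addr0.
have h2 : h ^+ 2 != 0 by rewrite expf_neq0.
apply: (mulfI h2); rewrite !E -!gdot_mxvec adjA gdotC //.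
Qed.

(** [C] gives the coordinates in an orthonormal eigenbasis of [lin_mx A] and [d] its eigenvalues.
    One basis serves all [phi], so identities mixing [A], its exponential and [phi1] of it reduce to
    scalar ones. *)
Lemma opfun_spectral (h : R) : h != 0 ->
  (forall v w, gdot h (A v) w = gdot h v (A w)) ->
  exists (C : {linear 'M[R]_M -> 'rV[R]_(M * M)}) (d : 'rV[R]_(M * M)),
  [/\ forall v w, gdot h v w = h ^+ 2 * \sum_k C v 0 k * C w 0 k,
      forall v k, C (A v) 0 k = d 0 k * C v 0 k &
      forall phi v k, C (opfun phi A v) 0 k = phi (d 0 k) * C v 0 k].
Proof.
move=> h0 adjA.
have [[P d] APd] := spectral_decomp_exists (lin_mx_sym h0 adjA).
have [/= PP AE] := APd; have PP' := mulmx1C PP.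
(* The rows of [P] are the eigenvectors, so a row vector has coordinates given by right
   multiplication by [P^T]. *)
exists (mulmxr P^T \o mxvec), d; split=> [v w|v k|phi v k] /=.
- rewrite gdot_mxvec; congr (_ * _).
  transitivity ((mxvec v *m (mxvec w)^T) 0 0).
    by rewrite mxE; apply: eq_bigr => k _; rewrite [in RHS]mxE.
  transitivity ((mxvec v *m P^T *m (mxvec w *m P^T)^T) 0 0).
    by rewrite trmx_mul trmxK mulmxA -(mulmxA _ P^T) PP' mulmx1.
  by rewrite mxE; apply: eq_bigr => k _; rewrite [X in _ * X]mxE.
- rewrite -mul_vec_lin AE !mulmxA -(mulmxA _ P) PP mulmx1 mul_mx_diag mxE.
  by rewrite mulrC.
rewrite /opfun vec_mxK (mxfunE phi APd) !mulmxA -(mulmxA _ P) PP mulmx1.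
by rewrite mul_mx_diag !mxE mulrC.
Qed.

Lemma exponential_step_dissipation (h tau : R) (u N w : 'M[R]_M) : h != 0 ->
  (forall v w, gdot h (A v) w = gdot h v (A w)) ->
  w = opfun (@expR R) A u + tau *: opfun (@phi1 R) A N - u ->
  0 <= gdot h (A u + tau *: N) w + gdot h (A w) w / 2.
Proof.
move=> h0 adjA wE; have [C [d [CE CA Cphi]]] := opfun_spectral h0 adjA.
rewrite !CE -mulrA -mulrDr mulr_ge0 ?sqr_ge0 //.
rewrite mulr_suml -big_split sumr_ge0 //= => k _.
pose q := d 0 k * C u 0 k + tau * C N 0 k.
have Cq : C (A u + tau *: N) 0 k = q by rewrite linearD linearZ /= !mxE CA.
have Cw : C w 0 k = phi1 (d 0 k) * q.
  rewrite wE linearB linearD linearZ /= !mxE !Cphi /q.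
  (* Subtracting [u] leaves the factor [expR d - 1 = d * phi1 d], so the terms in [u] and in [N]
     share the factor [phi1 d]. *)
  have -> : expR (d 0 k) = d 0 k * phi1 (d 0 k) + 1 by rewrite mulr_phi1 subrK.
  ring.
rewrite CA Cq Cw.
have -> : q * (phi1 (d 0 k) * q)
      + d 0 k * (phi1 (d 0 k) * q) * (phi1 (d 0 k) * q) / 2
    = phi1 (d 0 k) * q ^+ 2 * (1 + (d 0 k * phi1 (d 0 k)) / 2).
  by field.
rewrite mulr_phi1 mulr_ge0 //.
  by rewrite (mulr_ge0 (ltW (phi1_gt0 _)) (sqr_ge0 _)).
(* The last factor equals [(1 + expR d) / 2]. *)
by have := expR_gt0 (d 0 k); lra.
Qed.

End SelfAdjoint.

Lemma gsav_step_dissipation (R : realType) (M : nat) (h eps kappa tau : R)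
    (f F sigma : R -> R) (us : 'M[R]_M * R) :
  h != 0 -> 0 <= kappa -> (forall x, 0 < sigma x) -> 0 < tau ->
  modified_energy h eps (gsav_step h eps kappa tau f F sigma us).1
      (gsav_step h eps kappa tau f F sigma us).2
    <= modified_energy h eps us.1 us.2.
Proof.
case: us => u s h0 kappa_ge0 sigma_gt0 tau_gt0 /=.
set g := gfac h F sigma u s; pose c := kappa * g.
have c_ge0 : 0 <= c by apply: mulr_ge0 => //; apply: divr_ge0; apply: ltW.
pose A v := - tau *: Lop h eps kappa F sigma u s v.
have AE v : A v = (- tau * c) *: v + (tau * eps ^+ 2) *: lap h v.
  by rewrite /A /Lop -/g -/c scalerBr !scalerA [- tau * _ ^+ 2]mulNr scaleNr opprK.
have linA : linear A.
  by move=> a v w; apply/matrixP => i j; rewrite !AE lap_is_linear !mxE; ring.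
pose A' : {linear _ -> _} := HB.pack A (GRing.isLinear.Build _ _ _ _ A linA).
have adjA v w : gdot h (A' v) w = gdot h v (A' w).
  by rewrite /= !AE !gdotDl !gdotDr !gdotZl !gdotZr gdot_lapC.
have := @exponential_step_dissipation _ _ A' h tau u
  (Nop h kappa f F sigma u s u s) _ h0 adjA erefl.
rewrite /= -/A; set u1 := opfun _ _ _ + _; set w := u1 - u => main.
have u1E : u1 = u + w by rewrite /w addrC subrK.
(* From here on [w] is arbitrary apart from the inequality [main]. *)
move: u1 w u1E main => u1 w u1E main.
rewrite /modified_energy !gnorm2_grad u1E.
have -> : lap h (u + w) = lap h u + lap h w.
  by have := lap_is_linear h 1 u w; rewrite !scale1r.
move: main; rewrite !AE /Nop -/g -/c.
(* Self-adjointness of [lap] merges the two cross terms in [u] and [w]. *)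
rewrite !(gdotDl, gdotZl) !gdotDr (gdot_lapC _ w u) (gdotC _ w (lap h u)).
move: (gdot_ge0 h w) => ww_ge0 main.
have cww : 0 <= tau * (c * gdot h w w).
  by rewrite (mulr_ge0 (ltW tau_gt0) (mulr_ge0 c_ge0 ww_ge0)).
(* In [main] the terms in [c] times the product of [u] and [w] cancel, and the update of [s]
   supplies the term in [f u]. Hence [tau] times the energy decrease is the right side of [main]
   plus half that of [cww]. *)
rewrite -subr_ge0 -(pmulr_rge0 _ tau_gt0).
lra.
Qed.

Theorem theorem3p1 (R : realType) (L : R) (M : nat) (eps kappa beta : R)
    (f F sigma : R -> R) (uinit : 'M[R]_M)
    (L_gt0 : 0 < L) (M_gt0 : (0 < M)%N)
    (eps_gt0 : 0 < eps) (kappa_gt0 : 0 < kappa)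
    (f_C1 : C1 f)
    (beta_gt0 : 0 < beta) (f_beta : f beta <= 0) (f_Nbeta : 0 <= f (- beta))
    (F_deriv : forall x : R, is_derive x 1 F (- f x))
    (sigma_C1 : C1 sigma) (sigma_gt0 : forall x : R, 0 < sigma x)
    (dsigma_ge0 : forall x : R, 0 <= derive1 sigma x)
    (tau : R) (tau_gt0 : 0 < tau) (n : nat) :
  let h := L / M%:R in
  let us := gsav_ei1 h eps kappa tau f F sigma uinit in
  modified_energy h eps (us n.+1).1 (us n.+1).2
    <= modified_energy h eps (us n).1 (us n).2.
Proof.
cbv zeta; apply: gsav_step_dissipation => //; last exact: ltW.
by rewrite mulf_neq0 ?invr_eq0 ?pnatr_eq0 -?lt0n // gt_eqF.
Qed.
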